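(* Let $d, k \geq 1$ be integers with $k \geq d+1$, and let $\epsilon > 0$. There is a constant $C$ depending only on $d$, $k$ and $\epsilon$ such that for every graph $G$ with $n \geq 2$ vertices and maximum average degree $d - \epsilon$, the reconfiguration graph $R_k(G)$ is connected and has diameter at most $C\, n (\log n)^{d-1}$.
   Context: All graphs are finite and simple. A $k$-coloring of a graph $G$ is a function $f: V(G) \to \{1,\dots,k\}$ with $f(u) \neq f(v)$ for every edge $uv$. The reconfiguration graph $R_k(G)$ has as vertex set all $k$-colorings of $G$, two colorings being adjacent if they differ in the color of exactly one vertex of $G$. The maximum average degree of $G$ is $\max\{2|E(H)|/|V(H)| : H \subseteq G\}$. The paper states the bound as $O(n(\log n)^{d-1})$; here the implied constant is taken to depend only on the fixed parameters $d,k,\epsilon$. *)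

(* Defs.v *)
From HB Require Import structures.
From mathcomp Require Import all_boot all_order all_algebra.

Set Implicit Arguments.
Unset Strict Implicit.
Unset Printing Implicit Defensive.

Import Order.TTheory GRing.Theory Num.Theory.

Record sgraph := SGraph {
  vertex :> finType;
  adj : rel vertex;
  adj_sym : symmetric adj;
  adj_irrefl : irreflexive adj
}.

Section Graph.
Variable G : sgraph.

Definition edges : {set {set G}} :=
  [set E : {set G} | [exists u : G, exists v : G, adj u v && (E == [set u; v])]].

(* A nonempty subgraph of G, given by its vertex set and its edge set; it need
   not be induced. *)
Definition is_subgraph (S : {set G}) (F : {set {set G}}) : bool :=
  [&& S != set0, F \subset edges & [forall E in F, E \subset S]].

(* The value 0 of the empty maximum is the correct one for a graph with at least one
   vertex, as every ratio is nonnegative. *)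
Definition max_avg_degree (R : realFieldType) : R :=
  \big[Num.max/0%R]_(H : {set G} * {set {set G}} | is_subgraph H.1 H.2)
    ((2 * #|H.2|)%:R / #|H.1|%:R)%R.

Definition graph_connected : Prop :=
  (0 < #|G|)%N /\ forall x y : G, connect (@adj G) x y.

Definition has_walk (x y : G) (m : nat) : bool :=
  [exists p : m.-tuple G, path (@adj G) x p && (last x p == y)].

(* A shortest walk has fewer than #|G| edges; the default value #|G| is taken
   only by pairs of vertices in different components. *)
Definition distance (x y : G) : nat :=
  \big[minn/#|G|]_(m < #|G| | has_walk x y m) m.

Definition diameter : nat := \max_(x : G) \max_(y : G) distance x y.

Definition is_coloring (k : nat) (f : {ffun G -> 'I_k}) : bool :=
  [forall u : G, forall v : G, adj u v ==> (f u != f v)].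

Definition coloring (k : nat) : finType := {f : {ffun G -> 'I_k} | is_coloring f}.

Definition recolor (k : nat) : rel (coloring k) :=
  fun f g => #|[pred v : G | val f v != val g v]| == 1%N.

Lemma recolor_sym k : symmetric (@recolor k).
Proof.
move=> f g; rewrite /recolor; congr (_ == _).
by apply: eq_card => v; rewrite !inE eq_sym.
Qed.

Lemma recolor_irrefl k : irreflexive (@recolor k).
Proof.
by move=> f; rewrite /recolor eq_card0 // => v; rewrite !inE eqxx.
Qed.

Definition reconfiguration_graph (k : nat) : sgraph :=
  SGraph (@recolor_sym k) (@recolor_irrefl k).

End Graph.

(* Main.v *)
Require Import Defs.
From mathcomp Require Import all_boot all_order all_algebra.
From mathcomp Require Import reals sequences exp.
From mathcomp Require Import zify.

Set Implicit Arguments.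
Unset Strict Implicit.
Unset Printing Implicit Defensive.

Import Order.TTheory GRing.Theory Num.Theory.

(* Peeling off the vertices of degree less than d, which form a fixed proportion of
   every subgraph, splits the graph into s = O(log n) layers such that every vertex
   has fewer than d neighbors in its own and later layers. It remains to join any two
   colorings by O(n s^(d-1)) recolorings, by induction on d.

   Let I be the independent set of the vertices taken greedily, last layer first. Each
   vertex outside I has a neighbor in I in its own or a later layer. Once I has color
   a, the rest uses one color less and has one relevant neighbor less, and induction
   applies. So it suffices to rid a coloring of the color a, layer by layer. If the
   earlier layers L avoid a, let K be the class of a in the next layer, and choose
   greedily new colors other than a on L and K. The greedy independent set I of L,
   taken among the vertices not adjacent to color a, is painted a; by induction L \ I
   is moved to its new colors, which do not conflict with color a on K and I; then K,
   and then I, receive theirs. One layer thus costs O(n s^(d-2)) steps. *)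

Section BoundedWalks.
Variables (T : Type) (e : rel T).
Implicit Types (m n : nat) (x y z : T).

Definition reachable_in n x y : Prop :=
  exists p, [/\ path e x p, last x p = y & size p <= n].

Lemma reachable_in_refl x : reachable_in 0 x x.
Proof. by exists [::]. Qed.

Lemma reachable_in_leq m n x y : m <= n -> reachable_in m x y -> reachable_in n x y.
Proof.
by move=> le_mn [p [xp lp sp]]; exists p; split=> //; apply: leq_trans le_mn.
Qed.

Lemma reachable_in_trans m n x y z :
  reachable_in m x y -> reachable_in n y z -> reachable_in (m + n) x z.
Proof.
move=> [p [xp lp sp]] [q [yq lq sq]]; exists (p ++ q).
by rewrite cat_path last_cat size_cat lp xp yq lq leq_add.
Qed.

Lemma reachable_in_sym n x y :
  symmetric e -> reachable_in n x y -> reachable_in n y x.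
Proof.
move=> e_sym [p [xp <- sp]]; exists (rev (belast x p)); split.
- by rewrite rev_path (eq_path (e' := e)).
- by case: p {xp sp} => // z p; rewrite /= rev_cons last_rcons.
- by rewrite size_rev size_belast.
Qed.

End BoundedWalks.

Lemma distance_leq (G : sgraph) n (x y : G) :
  reachable_in (@adj G) n x y -> distance x y <= n.
Proof.
move=> [p [xp <- sp]]; case/shortenP: xp => q xq uq qp.
have ltq : size q < #|G| by move/card_uniqP: uq => /= <-; apply: max_card.
have leqn : size q <= n.
  by apply: leq_trans sp; apply: uniq_leq_size qp; case/andP: uq.
apply: leq_trans leqn.
apply: (@bigmin_le_cond _ nat _ _ (Ordinal ltq) _ (fun m : 'I_#|G| => m : nat)).
by apply/existsP; exists (in_tuple q); rewrite xq eqxx.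
Qed.

Lemma connected_diameter_leq (G : sgraph) n :
  0 < #|G| -> (forall x y : G, reachable_in (@adj G) n x y) ->
  graph_connected G /\ diameter G <= n.
Proof.
move=> G0 reachG; split; first split=> // x y.
  by have [p [xp lp _]] := reachG x y; apply/connectP; exists p.
by apply/bigmax_leqP => x _; apply/bigmax_leqP => y _; apply: distance_leq.
Qed.

Definition independent (G : sgraph) (S : {set G}) : Prop :=
  {in S &, forall u v, ~~ adj u v}.

Section Colorings.
Variables (G : sgraph) (k : nat).
Implicit Types (f g h : {ffun G -> 'I_k}) (S I : {set G}) (a : 'I_k).

Lemma is_coloringP f :
  reflect (forall u v, adj u v -> f u != f v) (is_coloring f).
Proof.
apply: (iffP 'forall_forallP) => [col u v | col u v]; first exact: implyP.
by apply/implyP; apply: col.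
Qed.

Definition agree_off S f g : Prop := forall v, v \notin S -> f v = g v.

Lemma agree_off_subset S S' f g :
  S \subset S' -> agree_off S f g -> agree_off S' f g.
Proof. by move=> sSS' fg v vS'; apply: fg; apply: contra (subsetP sSS' v) vS'. Qed.

Definition paint I a f : {ffun G -> 'I_k} :=
  [ffun v => if v \in I then a else f v].

Lemma is_coloring_paint I a f :
  is_coloring f -> independent I ->
  {in I, forall u v, adj u v -> v \notin I -> f v != a} ->
  is_coloring (paint I a f).
Proof.
move=> /is_coloringP col indI Ia; apply/is_coloringP => u v uv; rewrite !ffunE.
have [uI|uI] := ifPn; have [vI|vI] := ifPn.
- by rewrite (negbTE (indI _ _ uI vI)) in uv.
- by rewrite eq_sym; apply: (Ia u).
- by apply: (Ia v) => //; rewrite adj_sym.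
- exact: col.
Qed.

(* Recoloring on plain functions, which unlike colorings can be modified freely. *)
Definition recolor_ffun : rel {ffun G -> 'I_k} := fun f g =>
  [&& is_coloring f, is_coloring g & #|[pred v | f v != g v]| == 1].

Definition recolorable (n : nat) f g : Prop := reachable_in recolor_ffun n f g.

Lemma recolorable_sym n f g : recolorable n f g -> recolorable n g f.
Proof.
apply: reachable_in_sym => {}f {}g; rewrite /recolor_ffun andbCA.
by congr [&& _, _ & _ == 1]; apply: eq_card => v; rewrite !inE eq_sym.
Qed.

Lemma reachable_in_recolor n (f g : coloring G k) :
  recolorable n (val f) (val g) -> reachable_in (@recolor G k) n f g.
Proof.
move=> [p [fp lp sp]]; elim: p n f fp lp sp => [|h p IH] n f /=.
  by move=> _ /val_inj -> _; exists [::].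
move=> /andP[/and3P[_ col_h fh] hp] lp; case: n => // n sp.
have [q [hq lq sq]] := IH n (Sub h col_h) hp lp sp.
by exists (Sub h col_h :: q); split=> //=; rewrite hq andbT.
Qed.

Lemma recolorable_paint1 w a f :
  is_coloring f -> is_coloring (paint [set w] a f) ->
  recolorable 1 f (paint [set w] a f).
Proof.
move=> col_f col_p; have [fw|fw] := eqVneq (f w) a.
  suff -> : paint [set w] a f = f.
    exact: reachable_in_leq (leq0n 1) (reachable_in_refl _ f).
  by apply/ffunP => v; rewrite ffunE inE; case: eqVneq => // ->.
exists [:: paint [set w] a f]; split=> //=; rewrite andbT /recolor_ffun col_f col_p /=.
rewrite -(card1 w); apply/eqP/eq_card => v; rewrite !inE ffunE inE.
by case: (eqVneq v w) => [->|]; rewrite ?eqxx.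
Qed.

(* Every mixture of f and g is proper, so the vertices of S can be recolored in
   any order. *)
Lemma recolorable_independent S f g :
  is_coloring f -> is_coloring g -> independent S -> agree_off S f g ->
  recolorable #|S| f g.
Proof.
move=> + col_g; have [n] := ubnP #|S|; elim: n S f => // n IH S f ltSn col_f indS fg.
have [S0|/set0Pn[w wS]] := eqVneq S set0.
  suff -> : f = g by rewrite S0 cards0; apply: reachable_in_refl.
  by apply/ffunP => v; apply: fg; rewrite S0 inE.
have /is_coloringP proper_g := col_g.
have col_f' : is_coloring (paint [set w] (g w) f).
  apply: is_coloring_paint => // [u v /set1P-> /set1P->|u /set1P-> v wv _].
    by rewrite adj_irrefl.
  rewrite fg; first by apply: proper_g; rewrite adj_sym.
  by apply: contraL wv; apply: indS.
have cardS : #|S| = 1 + #|S :\ w| by rewrite (cardsD1 w) wS.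
rewrite cardS; apply: reachable_in_trans (recolorable_paint1 col_f col_f') _.
apply: IH => //; first by rewrite cardS in ltSn.
  by move=> u v /setD1P[_ uS] /setD1P[_ vS]; apply: indS.
by move=> v; rewrite !inE ffunE inE; case: eqVneq => [->|_] //=; apply: fg.
Qed.

Lemma recolorable_paint I a f :
  is_coloring f -> is_coloring (paint I a f) -> independent I ->
  recolorable #|I| f (paint I a f).
Proof.
move=> col_f col_p indI; apply: recolorable_independent => // v vI.
by rewrite ffunE (negbTE vI).
Qed.

Lemma independent_color_class I a f :
  is_coloring f -> {in I, forall v, f v = a} -> independent I.
Proof.
move=> /is_coloringP proper_f fI u v uI vI; apply/negP => /proper_f.
by rewrite !fI // eqxx.
Qed.

End Colorings.

Lemma max_level_ind (T : finType) (l : T -> nat) (P : {set T} -> Prop) :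
  P set0 ->
  (forall (S : {set T}) w, w \in S -> {in S, forall v, l v <= l w} ->
     (forall S' : {set T}, S' \proper S -> P S') -> P S) ->
  forall S, P S.
Proof.
move=> P0 PS S; have [n] := ubnP #|S|; elim: n S => // n IH S ltSn.
have [->//|/set0Pn[w0 w0S]] := eqVneq S set0.
case: (arg_maxnP l w0S) => w wS max_w; apply: (PS S w) => // S' /proper_card ltS'.
exact: IH (leq_trans ltS' ltSn).
Qed.

Section Levels.
Variables (G : sgraph) (l : G -> nat).
Implicit Types (S I M N K : {set G}).

Definition later_nbrs S v : {set G} := [set u in S | adj v u && (l v <= l u)].

Definition below (r : nat) S : {set G} := [set v in S | l v < r].

Lemma below_subset r S : below r S \subset S.
Proof. by apply/subsetP => v /setIdP[]. Qed.

Definition layering (s d : nat) S : Prop :=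
  {in S, forall v, l v < s /\ #|later_nbrs S v| < d}.

Lemma kernel_exists S :
  exists I, [/\ I \subset S, independent I &
    {in S :\: I, forall v, exists u, u \in later_nbrs I v}].
Proof.
elim/(@max_level_ind _ l): S => [|S w wS max_w IH].
  by exists set0; split=> // u; rewrite !inE.
pose S' := [set v in S :\ w | ~~ adj w v].
have [|I [sIS' indI domI]] := IH S'.
  by apply: sub_proper_trans (properD1 wS); apply/subsetP => v /setIdP[].
have inI v : v \in I -> [/\ v != w, v \in S & ~~ adj w v].
  by move=> /(subsetP sIS'); rewrite !inE -andbA => /and3P[].
exists (w |: I); split.
- by rewrite subUset sub1set wS; apply/subsetP => v /inI[].
- move=> u v /setU1P[->|uI] /setU1P[->|vI]; rewrite ?adj_irrefl //.
  + by case/inI: vI.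
  + by rewrite adj_sym; case/inI: uI.
  + exact: indI.
- move=> v; rewrite !inE negb_or -andbA => /and3P[vw vI vS].
  have [wv|nwv] := boolP (adj w v).
    by exists w; rewrite !inE eqxx adj_sym wv max_w.
  have [|u] := domI v; first by rewrite !inE vI vw vS.
  by rewrite !inE => /andP[uI uv]; exists u; rewrite !inE uI uv orbT.
Qed.

Variable k : nat.
Implicit Types (f g h : {ffun G -> 'I_k}) (A B : {set 'I_k}) (a : 'I_k).

(* The vertices outside M keep their colors, so such a neighbor only matters if its
   color belongs to the palette A. *)
Definition obstacles A M f v : {set G} :=
  [set u | adj v u && (if u \in M then l v <= l u else f u \in A)].

Definition few_obstacles d A M f : Prop :=
  {in M, forall v, #|obstacles A M f v| < d}.

Definition palette_coloring A M f : Prop :=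
  is_coloring f /\ {in M, forall v, f v \in A}.

Lemma few_obstacles_setT s d A f : layering s d setT -> few_obstacles d A setT f.
Proof.
move=> lay v vT; have [_] := lay v vT; rewrite (eq_card (B := obstacles A setT f v)) //.
by move=> u; rewrite !inE.
Qed.

Lemma few_obstacles_subset d A B M N f g :
  few_obstacles d A M f -> B \subset A -> N \subset M -> agree_off M f g ->
  {in N & M :\: N, forall v u, l v <= l u} -> few_obstacles d B N g.
Proof.
move=> few sBA sNM fg lNM v vN; apply: leq_ltn_trans (few v (subsetP sNM v vN)).
apply: subset_leq_card; apply/subsetP => u; rewrite !inE => /andP[-> /=].
have [uN|uN] := boolP (u \in N); first by rewrite (subsetP sNM).
have [uM|uM] := boolP (u \in M); first by rewrite lNM // inE uN.
by rewrite fg //; apply: (subsetP sBA).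
Qed.

Lemma few_obstacles_agree d A M f g :
  few_obstacles d A M f -> agree_off M f g -> few_obstacles d A M g.
Proof.
move=> few fg; apply: few_obstacles_subset few _ _ fg _ => // v u _.
by rewrite setDv inE.
Qed.

Lemma few_obstacles_between d r A B M N f :
  few_obstacles d A M f -> {in M, forall v, l v < r.+1} -> B \subset A ->
  below r M \subset N -> N \subset M -> few_obstacles d B N f.
Proof.
move=> few lM sBA sLN sNM; apply: (few_obstacles_subset few sBA sNM) => // v u vN.
case/setDP=> uM uN; apply: (@leq_trans r); first exact: lM (subsetP sNM v vN).
by have := contra (subsetP sLN u) uN; rewrite inE uM /= -leqNgt.
Qed.

Lemma palette_coloring_subset A M N f :
  N \subset M -> palette_coloring A M f -> palette_coloring A N f.
Proof. by move=> sNM [col_f fA]; split=> // v /(subsetP sNM)/fA. Qed.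

Lemma greedy_coloring A M f :
  {in ~: M &, forall u v, adj u v -> f u != f v} -> few_obstacles #|A| A M f ->
  exists2 g, palette_coloring A M g & agree_off M f g.
Proof.
elim/(@max_level_ind _ l): M f => [|M w wM max_w IH] f proper_f few.
  exists f => //; split=> [|v]; last by rewrite inE.
  by apply/is_coloringP => u v; apply: proper_f; rewrite !inE.
have /subsetPn[c cA cN] : ~~ (A \subset f @: (obstacles A M f w :\: M)).
  apply: contraL (few w wM) => /subset_leq_card leA; rewrite -leqNgt.
  apply: leq_trans leA (leq_trans (leq_imset_card _ _) _).
  exact: subset_leq_card (subsetDl _ _).
have free_c v : adj w v -> v \notin M -> f v != c.
  move=> wv vM; apply: contraNneq cN => fv; rewrite -fv imset_f //.
  by rewrite !inE wv (negbTE vM) fv cA.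
pose f' := paint [set w] c f.
have [| |g [col_g gA] f'g] := IH (M :\ w) (properD1 wM) f'.
- move=> u v; rewrite !inE !ffunE !inE.
  case: (eqVneq u w) => [->|uw] /=; case: (eqVneq v w) => [->|vw] //=.
  + by rewrite adj_irrefl.
  + by move=> _ vM wv; rewrite eq_sym free_c.
  + by move=> uM _; rewrite adj_sym => wu; apply: free_c.
  + by move=> uM vM; apply: proper_f; rewrite inE.
- move=> v /setD1P[vw vM]; apply: leq_ltn_trans (few v vM).
  apply: subset_leq_card; apply/subsetP => u; rewrite !inE ffunE inE => /andP[-> /=].
  by case: eqVneq => [->|] //= _; rewrite wM max_w.
exists g; last first.
  move=> v vM; rewrite -f'g ?inE ?negb_and ?vM ?orbT // ffunE inE.
  by case: eqVneq vM => // ->; rewrite wM.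
split=> // v vM; have [->|vw] := eqVneq v w; last by rewrite gA // !inE vw.
by rewrite -f'g ?inE ?eqxx // ffunE inE eqxx.
Qed.

Definition greedy_class M a f I : Prop :=
  [/\ I \subset M, independent I,
    {in I, forall u v, adj u v -> v \notin M -> f v != a} &
    {in M :\: I, forall v, exists2 u, adj v u &
      (u \notin M) && (f u == a) || (u \in later_nbrs I v)}].

Lemma greedy_class_exists M a f : exists I, greedy_class M a f I.
Proof.
pose blocked v := [exists u, [&& adj v u, u \notin M & f u == a]].
have [I [sI indI domI]] := kernel_exists [set v in M | ~~ blocked v].
exists I; split=> //.
- by apply: subset_trans sI _; apply/subsetP => v /setIdP[].
- move=> u /(subsetP sI)/setIdP[_ /existsPn free_u] v uv vM.
  by have := free_u v; rewrite uv vM.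
- move=> v /setDP[vM vI].
  have [/existsP[u /and3P[vu uM fu]]|free_v] := boolP (blocked v).
    by exists u; rewrite // uM fu.
  have [|u uI] := domI v; first by rewrite !inE vI vM free_v.
  by exists u; rewrite ?uI ?orbT //; move: uI; rewrite inE => /and3P[].
Qed.

Lemma is_coloring_paint_greedy_class M a f g I :
  greedy_class M a f I -> is_coloring g -> {in M, forall v, g v != a} ->
  (forall v, v \notin M -> g v = a -> f v = a) -> is_coloring (paint I a g).
Proof.
move=> [sIM indI freeI _] col_g ga gf; apply: is_coloring_paint => // u uI v uv _.
have [/ga//|vM] := boolP (v \in M).
by apply: contraNneq (freeI u uI v uv vM) => /(gf v vM) ->.
Qed.

(* A vertex of M outside I loses the neighbor that kept it out of I. *)
Lemma few_obstacles_paint d A M a f I :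
  a \in A -> few_obstacles d.+1 A M f -> greedy_class M a f I ->
  few_obstacles d (A :\ a) (M :\: I) (paint I a f).
Proof.
move=> aA few [sIM indI _ domI] v vMI; have /setDP[vM vI] := vMI.
rewrite -ltnS; apply: leq_trans (few v vM).
apply: proper_card; apply/properP; split.
  apply/subsetP => x; rewrite !inE ffunE => /andP[-> /=].
  have [xI|xI] := boolP (x \in I); first by rewrite eqxx.
  by rewrite /=; case: ifP => // _ /andP[].
have [u vu dom_u] := domI v vMI; exists u; rewrite !inE vu ?ffunE.
  case/orP: dom_u => [/andP[uM /eqP->]|]; first by rewrite (negbTE uM).
  by rewrite inE => /and3P[uI _]; rewrite (subsetP sIM).
case/orP: dom_u => [/andP[uM /eqP fu]|].
  by rewrite (negbTE uM) andbF fu if_same eqxx.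
by rewrite inE => /and3P[uI _ _]; rewrite uI eqxx.
Qed.

Definition reconfigurable d t : Prop := forall A M f g,
  d < #|A| -> few_obstacles d A M f ->
  palette_coloring A M f -> palette_coloring A M g -> agree_off M f g ->
  recolorable (#|M| * t) f g.

Lemma reconfigurable1 : reconfigurable 1 1.
Proof.
move=> A M f g _ few [col_f _] [col_g _] fg; rewrite muln1.
apply: recolorable_independent => // u v.
wlog luv : u v / l u <= l v.
  move=> nadj uM vM; have [|/ltnW] := leqP (l u) (l v) => luv; first exact: nadj.
  by rewrite adj_sym; apply: nadj.
move=> uM vM; have := few u uM; rewrite ltnS leqn0 cards_eq0 => /eqP/setP/(_ v).
by rewrite !inE vM luv andbT => ->.
Qed.

Section RemoveColor.
Variables (d t : nat) (A : {set 'I_k}) (a : 'I_k).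
Hypotheses (recon : reconfigurable d t) (ltdA : d.+1 < #|A|) (aA : a \in A).

Lemma card_paletteD1_gt : d < #|A :\ a|.
Proof. by move: ltdA; rewrite (cardsD1 a A) aA. Qed.

Lemma palette_coloring_neq M f :
  palette_coloring (A :\ a) M f -> {in M, forall v, f v != a}.
Proof. by move=> [_ fA] v /fA /setD1P[]. Qed.

Lemma recolorable_greedy_class M f g I :
  few_obstacles d.+1 A M f -> greedy_class M a f I -> agree_off M f g ->
  palette_coloring (A :\ a) M f -> palette_coloring (A :\ a) M g ->
  recolorable (#|M :\: I| * t) (paint I a f) (paint I a g).
Proof.
move=> few clI fg pal_f pal_g.
have palette_paint h : agree_off M f h -> palette_coloring (A :\ a) M h ->
    palette_coloring (A :\ a) (M :\: I) (paint I a h).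
  move=> fh pal_h; have [col_h hA] := pal_h; split.
    apply: is_coloring_paint_greedy_class clI col_h (palette_coloring_neq pal_h) _.
    by move=> v vM <-; apply: fh.
  by move=> v /setDP[vM vI]; rewrite ffunE (negbTE vI) hA.
apply: recon card_paletteD1_gt (few_obstacles_paint aA few clI) _ _ _.
- exact: palette_paint.
- exact: palette_paint.
- move=> v; rewrite !inE !ffunE negb_and negbK.
  by case: ifP => //= _; apply: fg.
Qed.

Section Repaint.
Variables (M K : {set G}) (f g : {ffun G -> 'I_k}).
Hypotheses (fK : {in K, forall v, f v = a}) (fg : agree_off (M :|: K) f g).
Hypotheses (pal_f : palette_coloring (A :\ a) M f).
Hypotheses (pal_g : palette_coloring (A :\ a) M g).

Lemma agree_off_paint : agree_off M f (paint K a g).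
Proof.
move=> v vM; rewrite ffunE; case: ifPn => [/fK//|vK].
by apply: fg; rewrite inE negb_or vM.
Qed.

Lemma palette_coloring_paint : palette_coloring (A :\ a) M (paint K a g).
Proof.
have [[col_f _] [col_g gA]] := (pal_f, pal_g).
split=> [|v vM]; last first.
  rewrite ffunE ifN ?gA //.
  by apply: contra (palette_coloring_neq pal_f vM) => /fK ->.
apply: is_coloring_paint (independent_color_class col_f fK) _ => // u uK v uv vK.
have [/(palette_coloring_neq pal_g)//|vM] := boolP (v \in M).
rewrite -fg ?inE ?negb_or ?vM // -(fK uK) eq_sym.
by move/is_coloringP: col_f => ->.
Qed.

Lemma recolorable_repaint :
  few_obstacles d.+1 A M f -> recolorable (#|M| * t.+2 + #|K|) f g.
Proof.
move=> few; have [[col_f _] [col_g _]] := (pal_f, pal_g).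
have [I clI] := greedy_class_exists M a f.
have [sIM indI _ _] := clI.
have col_paint h : (forall v, v \notin M -> h v = a -> f v = a) ->
    palette_coloring (A :\ a) M h -> is_coloring (paint I a h).
  move=> hf pal_h; have [col_h _] := pal_h.
  exact: is_coloring_paint_greedy_class clI col_h (palette_coloring_neq pal_h) hf.
have f_If : recolorable #|I| f (paint I a f).
  by apply: recolorable_paint => //; apply: col_paint.
have If_Ih : recolorable (#|M :\: I| * t) (paint I a f) (paint I a (paint K a g)).
  apply: recolorable_greedy_class few clI agree_off_paint pal_f _.
  exact: palette_coloring_paint.
have col_Ig : is_coloring (paint I a g).
  apply: col_paint => // v vM gv; have [/fK//|vK] := boolP (v \in K).
  by rewrite fg // inE negb_or vM.
have Ih_Ig : recolorable #|K| (paint I a (paint K a g)) (paint I a g).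
  apply: recolorable_independent => //.
  - by apply: col_paint palette_coloring_paint => v vM <-; apply: agree_off_paint.
  - exact: independent_color_class col_f fK.
  - by move=> v vK; rewrite !ffunE (negbTE vK).
have Ig_g := recolorable_sym (recolorable_paint col_g col_Ig indI).
have leIM := subset_leq_card sIM.
have leMI : #|M :\: I| * t <= #|M| * t by rewrite leq_mul ?subset_leq_card ?subsetDl.
apply: reachable_in_leq (reachable_in_trans f_If
  (reachable_in_trans If_Ih (reachable_in_trans Ih_Ig Ig_g))).
by rewrite !mulnS; lia.
Qed.

End Repaint.

Lemma recolorable_next_layer r M f :
  {in M, forall v, l v < r.+1} -> few_obstacles d.+1 A M f ->
  palette_coloring A M f -> palette_coloring (A :\ a) (below r M) f ->
  exists g, [/\ palette_coloring (A :\ a) M g, agree_off M f g &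
    recolorable (#|M| * t.+3) f g].
Proof.
move=> lM few [col_f fA] pal_f; set L := below r M in pal_f.
pose K := [set v in M | f v == a].
have sLM : L \subset M := below_subset r M.
have sKM : K \subset M by apply/subsetP => v /setIdP[].
have sLKM : L :|: K \subset M by rewrite subUset sLM.
have [|v vLK|g [col_g gA] fg] := @greedy_coloring (A :\ a) (L :|: K) f.
- by move=> u v _ _; move: u v; apply/is_coloringP.
- apply: leq_trans card_paletteD1_gt.
  by apply: (few_obstacles_between few lM) => //; [apply: subD1set|apply: subsetUl].
have pal_g : palette_coloring (A :\ a) M g.
  split=> // v vM; have [/gA//|vLK] := boolP (v \in L :|: K).
  rewrite -fg // !inE fA // andbT.
  by move: vLK; rewrite !inE vM negb_or => /andP[].
exists g; split=> //; first exact: agree_off_subset fg.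
have f_g : recolorable (#|L| * t.+2 + #|K|) f g.
  apply: recolorable_repaint fg pal_f (palette_coloring_subset sLM pal_g) _.
    by move=> v /setIdP[_ /eqP].
  exact: few_obstacles_between few lM _ _ _.
apply: reachable_in_leq f_g.
by rewrite (mulnS _ t.+2) addnC leq_add ?leq_mul ?subset_leq_card.
Qed.

Lemma recolorable_remove_color r M f :
  {in M, forall v, l v < r} -> few_obstacles d.+1 A M f -> palette_coloring A M f ->
  exists g, [/\ palette_coloring (A :\ a) M g, agree_off M f g &
    recolorable (#|M| * (r * t.+3)) f g].
Proof.
elim: r M f => [|r IH] M f lM few pal_f.
  exists f; split=> //; last by rewrite muln0; apply: reachable_in_refl.
  by case: pal_f => col_f _; split=> // v /lM.
have sLM := below_subset r M.
have [|||f1 [pal_f1 ff1 f_f1]] := IH (below r M) f.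
- by move=> v /setIdP[].
- exact: few_obstacles_between few lM _ _ _.
- exact: palette_coloring_subset pal_f.
have ff1M := agree_off_subset sLM ff1.
have pal_f1M : palette_coloring A M f1.
  have [[_ fA] [col_f1 f1A]] := (pal_f, pal_f1); split=> // v vM.
  by have [/f1A /setD1P[]//|vL] := boolP (v \in below r M); rewrite -ff1 ?fA.
have [g [pal_g f1g f1_g]] :=
  recolorable_next_layer lM (few_obstacles_agree few ff1M) pal_f1M pal_f1.
exists g; split=> //; first by move=> v vM; rewrite ff1M ?f1g.
apply: reachable_in_leq (reachable_in_trans f_f1 f1_g).
by rewrite mulSn mulnDr addnC leq_add // leq_mul ?subset_leq_card.
Qed.

End RemoveColor.

Lemma reconfigurableS d s t :
  (forall v, l v < s) -> reconfigurable d t ->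
  reconfigurable d.+1 ((s * t.+3).*2 + t.+2).
Proof.
move=> ls recon A M f g ltdA few pal_f pal_g fg.
have [a aA] : exists a, a \in A by apply/card_gt0P; apply: leq_trans ltdA.
have remove := @recolorable_remove_color _ _ _ _ recon ltdA aA s M _ (in1W ls).
have [f' [pal_f' ff' f_f']] := remove f few pal_f.
have [g' [pal_g' gg' g_g']] := remove g (few_obstacles_agree few fg) pal_g.
have f'g' : agree_off (M :|: set0) f' g'.
  by move=> v; rewrite setU0 => vM; rewrite -ff' // -gg' // fg.
have f'_g' : recolorable (#|M| * t.+2 + #|@set0 G|) f' g'.
  apply: (recolorable_repaint recon ltdA aA) f'g' pal_f' pal_g' _.
    by move=> v; rewrite inE.
  exact: few_obstacles_agree few ff'.
rewrite cards0 addn0 in f'_g'.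
apply: reachable_in_leq
  (reachable_in_trans f_f' (reachable_in_trans f'_g' (recolorable_sym g_g'))).
by rewrite -addnn !mulnDr; lia.
Qed.

Fixpoint recolor_bound s d := match d with
  | d'.+1 => (s * (recolor_bound s d').+3).*2 + (recolor_bound s d').+2
  | 0 => 1
  end.

Lemma reconfigurable_recolor_bound s d :
  (forall v, l v < s) -> reconfigurable d.+1 (recolor_bound s d).
Proof.
by move=> ls; elim: d => [|d IH]; [apply: reconfigurable1|apply: reconfigurableS].
Qed.

End Levels.

Lemma recolor_bound_leq_expn d :
  exists c, forall s, 0 < s -> recolor_bound s d <= c * s ^ d.
Proof.
elim: d => [|d [c IH]]; first by exists 1.
exists (3 * c + 8) => s s0 /=; have := IH s s0; set t := recolor_bound s d => le_t.
have sd0 : 1 <= s ^ d by rewrite expn_gt0 s0.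
have le_st := leq_mul (leqnn s) le_t; have le_ssd := leq_mul (leqnn s) sd0.
have le_csd := leq_mul s0 (leqnn (c * s ^ d)).
by rewrite expnS; nia.
Qed.

Lemma reconfiguration_graph_diameter_leq (G : sgraph) k d s (l : G -> nat) :
  d.+1 < k -> layering l s d.+1 [set: G] ->
  graph_connected (reconfiguration_graph G k) /\
  diameter (reconfiguration_graph G k) <= #|G| * recolor_bound s d.
Proof.
move=> ltdk lay; have ls v : l v < s by have [] := lay v (in_setT v).
have few (f : {ffun G -> 'I_k}) := few_obstacles_setT setT f lay.
have ltdT : d.+1 < #|[set: 'I_k]| by rewrite cardsT card_ord.
pose f0 : {ffun G -> 'I_k} := [ffun=> Ordinal (leq_ltn_trans (leq0n d.+1) ltdk)].
have [|v vT|g0 [col_g0 _] _] := @greedy_coloring G l k setT setT f0.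
- by move=> u v; rewrite !inE.
- exact: ltn_trans (few f0 v vT) ltdT.
apply: connected_diameter_leq => [|f g].
  by apply/card_gt0P; exists (Sub g0 col_g0 : coloring G k).
apply: reachable_in_recolor; rewrite -cardsT.
have pal (h : coloring G k) : palette_coloring setT setT (val h).
  by split=> [|v _]; [apply: valP|rewrite inE].
apply: reconfigurable_recolor_bound (ls) _ _ _ _ ltdT (few _) (pal f) (pal g) _.
by move=> v; rewrite inE.
Qed.

Section Sparsity.
Variable G : sgraph.
Implicit Types (S : {set G}) (d s : nat).

Definition nbrs_in S v : {set G} := [set u in S | adj v u].

Definition edges_in S : {set {set G}} := [set E in edges G | E \subset S].

Lemma sum_nbrs_in S : \sum_(v in S) #|nbrs_in S v| = 2 * #|edges_in S|.
Proof.
under eq_bigr => v _ do rewrite -sum1_card.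
rewrite pair_big_dep /= (partition_big (fun p : G * G => [set p.1; p.2])
  (mem (edges_in S))) /=; last first.
  move=> [u v] /=; rewrite !inE => /and3P[uS vS uv].
  rewrite subUset !sub1set uS vS !andbT.
  by apply/existsP; exists u; apply/existsP; exists v; rewrite uv eqxx.
rewrite mulnC -sum_nat_const; apply: eq_bigr => E.
rewrite !inE => /andP[/existsP[u /existsP[v /andP[uv /eqP->]]]].
rewrite subUset !sub1set => /andP[uS vS].
have neq_uv : u != v by apply: contraTneq uv => ->; rewrite adj_irrefl.
rewrite sum1_card -(_ : #|[set (u, v); (v, u)]| = 2); last first.
  by rewrite cards2 xpair_eqE negb_and neq_uv.
apply: eq_card => -[x y]; rewrite [LHS]unfold_in /= !inE !xpair_eqE.
apply/idP/idP => [/andP[/and3P[_ _ xy] /eqP/setP exy]|].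
  move: (exy x) (exy y) xy; rewrite !inE !eqxx orbT /=.
  by move=> /esym/orP[]/eqP -> /esym/orP[]/eqP ->; rewrite ?adj_irrefl ?eqxx ?orbT.
case/orP=> /andP[/eqP-> /eqP->]; first by rewrite uS vS uv eqxx.
by rewrite uS vS adj_sym uv setUC eqxx.
Qed.

Definition high_degree d S : {set G} := [set v in S | d <= #|nbrs_in S v|].

Lemma layering_high_degree l s d S :
  layering l s d (high_degree d S) ->
  layering (fun v => if v \in high_degree d S then (l v).+1 else 0) s.+1 d S.
Proof.
move=> lay v vS; have [vH|vH] := ifPn.
  have [lv dv] := lay v vH; split=> //; apply: leq_ltn_trans dv.
  apply: subset_leq_card; apply/subsetP => u.
  rewrite [u \in _]inE vH => /and3P[uS vu].
  by case: ifPn => // uH luv; rewrite inE uH vu.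
split=> //; move: vH; rewrite inE vS /= -ltnNge; apply: leq_ltn_trans.
by apply: subset_leq_card; apply/subsetP => u; rewrite !inE => /and3P[-> ->].
Qed.

Local Open Scope ring_scope.
Variable R : realFieldType.

Lemma card_edges_in_le S :
  (2 * #|edges_in S|)%:R <= max_avg_degree G R * #|S|%:R.
Proof.
have [->|S0] := eqVneq S set0.
  by rewrite cards0 mulr0 -sum_nbrs_in big_set0.
rewrite -ler_pdivrMr ?ltr0n ?card_gt0 //.
apply: (@le_bigmax_cond _ _ _ _ (S, edges_in S) _
  (fun H : {set G} * {set {set G}} => (2 * #|H.2|)%:R / #|H.1|%:R : R)).
apply/and3P; split=> //=; first by apply/subsetP => E /setIdP[].
by apply/forallP => E; apply/implyP; rewrite inE => /andP[].
Qed.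

Lemma card_high_degree_le d S :
  d%:R * #|high_degree d S|%:R <= max_avg_degree G R * #|S|%:R.
Proof.
apply: le_trans (card_edges_in_le S).
rewrite -natrM ler_nat -sum_nbrs_in mulnC -sum_nat_const.
under eq_bigl => v do rewrite inE.
by rewrite big_mkcondr; apply: leq_sum => v _; case: ifP.
Qed.

Lemma layering_exists d (q : R) : 0 <= q ->
  (forall S, #|high_degree d S|%:R <= q * #|S|%:R) ->
  forall s S, q ^+ s * #|S|%:R < 1 -> exists l : G -> nat, layering l s d S.
Proof.
move=> q0 high; elim=> [|s IH] S.
  rewrite mul1r ltrn1 ltnS leqn0 cards_eq0 => /eqP->.
  by exists (fun=> 0%N) => v; rewrite inE.
rewrite exprSr -mulrA => qS; have [|l lay] := IH (high_degree d S).
  by apply: le_lt_trans qS; rewrite ler_wpM2l ?exprn_ge0.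
by eexists; apply: layering_high_degree lay.
Qed.

End Sparsity.

Local Open Scope ring_scope.

Lemma expr_onem_lt1 (R : realType) (delta x : R) (s : nat) :
  delta <= 1 -> 0 < x -> ln x < delta * s%:R -> (1 - delta) ^+ s * x < 1.
Proof.
move=> delta1 x0 lt_ln.
have le_exp : (1 - delta) ^+ s <= expR (- (delta * s%:R)).
  by rewrite -mulNr expRM_natr lerXn2r ?nnegrE ?expR_ge0 ?subr_ge0 // expR_ge1Dx.
apply: le_lt_trans (ler_wpM2r (ltW x0) le_exp) _.
by rewrite -[X in _ * X]lnK // -expRD -[ltRHS]expR0 ltr_expR addrC subr_lt0.
Qed.

Lemma logarithmic_layering_exists (R : realType) (G : sgraph) (d : nat) (eps : R) :
  (0 < d)%N -> 0 < eps -> (2 <= #|G|)%N -> max_avg_degree G R <= d%:R - eps ->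
  exists s (l : G -> nat), [/\ (0 < s)%N, layering l s d [set: G] &
    s%:R <= (d%:R / eps + (ln 2)^-1) * ln #|G|%:R :> R].
Proof.
move=> d0 eps0 n2 mad; have d0R : 0 < d%:R :> R by rewrite ltr0n.
pose delta := eps / d%:R; have delta0 : 0 < delta by rewrite divr_gt0.
have ln2_gt0 : 0 < ln 2 :> R by rewrite ln_gt0 // ltr1n.
have ln2_le : ln 2 <= ln #|G|%:R :> R by rewrite ler_ln ?posrE ?ltr0n ?ler_nat // ltnW.
have ln_ge0 := le_trans (ltW ln2_gt0) ln2_le.
have high (S : {set G}) : #|high_degree d S|%:R <= (1 - delta) * #|S|%:R.
  rewrite -(ler_pM2l d0R) mulrA mulrBr mulr1 mulrCA mulfV ?gt_eqF // mulr1.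
  by apply: le_trans (card_high_degree_le R d S) _; rewrite ler_wpM2r.
have n0R : 0 < #|G|%:R :> R by rewrite ltr0n ltnW.
have q0 : 0 <= 1 - delta.
  by have := le_trans (ler0n _ _) (high setT); rewrite cardsT pmulr_lge0.
pose s := (Num.truncn (ln #|G|%:R / delta)).+1.
have lt_s : ln #|G|%:R < delta * s%:R by rewrite mulrC -ltr_pdivrMr // truncnS_gt.
have [|l lay] := layering_exists q0 high (s := s) (S := setT).
  by rewrite cardsT expr_onem_lt1 // -subr_ge0.
exists s, l; split=> //; rewrite /s -natr1 mulrDl lerD //.
  by rewrite -[d%:R / eps]invf_div [leRHS]mulrC truncn_le divr_ge0 // ltW.
by rewrite [leRHS]mulrC ler_pdivlMr ?mul1r.
Qed.

Theorem theorem1 (R : realType) (d k : nat) (hd : (1 <= d)%N) (hk : (1 <= k)%N)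
    (hdk : (d + 1 <= k)%N) (eps : R) (heps : 0 < eps) :
  exists C : R, forall G : sgraph, (2 <= #|G|)%N ->
    max_avg_degree G R = d%:R - eps ->
    graph_connected (reconfiguration_graph G k) /\
    (diameter (reconfiguration_graph G k))%:R
      <= C * #|G|%:R * ln (#|G|%:R) ^+ (d - 1).
Proof.
case: d hd hdk => // d d0; rewrite addn1 subn1 /= => ltdk.
have [c bound] := recolor_bound_leq_expn d.
exists (c%:R * (d.+1%:R / eps + (ln 2)^-1) ^+ d) => G n2 mad.
have [|s [l [s0 lay s_le]]] := logarithmic_layering_exists d0 heps n2.
  by rewrite mad.
have [conn diam] := reconfiguration_graph_diameter_leq ltdk lay.
split=> //; apply: (@le_trans _ _ (#|G|%:R * (c%:R * s%:R ^+ d))).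
  by rewrite -natrX -!natrM ler_nat (leq_trans diam) // leq_mul // bound.
rewrite [leRHS]mulrAC [leRHS]mulrC -mulrA -exprMn.
by rewrite !ler_wpM2l // lerXn2r ?nnegrE // (le_trans _ s_le).
Qed.
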